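(* Let $m,n,p,q$ be positive integers with $p+q=m\ge n$, let $A_1\in\mathbb{R}^{p\times n}$ have full column rank, let $A_2\in\mathbb{R}^{q\times n}$, and put $A=\begin{bmatrix} A_1 \\ A_2 \end{bmatrix}\in\mathbb{R}^{m\times n}$, $J=\operatorname{diag}(I_p,-I_q)$ and $b\in\mathbb{R}^m$. Assume that $A^TJA$ is symmetric positive definite, so that the indefinite least squares problem $\min_{x\in\mathbb{R}^n}(b-Ax)^TJ(b-Ax)$ has a unique solution, namely the unique solution $x^\ast$ of the normal equation $A^TJAx=A^TJb$. For a real parameter $\alpha$, consider the double splitting (DS) iteration $$x^{k+1}=P^{-1}R\,x^{k}+P^{-1}S\,x^{k-1}+P^{-1}A^TJb,\qquad k=1,2,\dots,$$ where $$P=\alpha I+A_1^TA_1,\qquad R=A_2^TA_2,\qquad S=\alpha I.$$ Then for every $\alpha>0$ the DS iteration method is convergent; that is, for all initial vectors $x^0,x^1\in\mathbb{R}^n$, the sequence $(x^k)$ converges to $x^\ast$.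
   Context: Here $I$ is the $n\times n$ identity matrix, $I_p$ and $I_q$ are the identity matrices of orders $p$ and $q$, and $A^TJA=A_1^TA_1-A_2^TA_2=P-R-S$ is called a double splitting of $A^TJA$ (with $P$ nonsingular). The DS iteration can equivalently be written in block form as $$\begin{bmatrix} x^{k+1} \\ x^k \end{bmatrix}=W\begin{bmatrix} x^{k} \\ x^{k-1} \end{bmatrix}+\begin{bmatrix} P^{-1}A^TJb \\ \mathbf{0} \end{bmatrix},\qquad W=\begin{bmatrix} P^{-1}R & P^{-1}S \\ I & \mathbf{0} \end{bmatrix},\qquad k=1,2,\dots.$$ The double splitting (and the DS iteration method) is said to be convergent when, for any initial vectors $x^0,x^1$, the generated sequence converges to the unique solution of the indefinite least squares problem, which is the case if and only if the spectral radius satisfies $\rho(W)<1$. *)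

(* Defs.v *)
From mathcomp Require Import all_boot all_order all_algebra.
From mathcomp Require Import all_classical all_reals all_analysis.
Import Order.TTheory GRing.Theory Num.Theory.
Import numFieldNormedType.Exports.

Set Implicit Arguments.
Unset Strict Implicit.
Unset Printing Implicit Defensive.

Local Open Scope classical_set_scope.
Local Open Scope ring_scope.

Definition signature_mx (K : realType) (p q : nat) : 'M[K]_(p + q) :=
  block_mx 1%:M 0 0 (- 1%:M).

Definition sym_posdef (K : realType) (n : nat) (M : 'M[K]_n) : Prop :=
  M^T = M /\
  forall x : 'cV[K]_n, x != 0 -> 0 < (x^T *m M *m x) ord0 ord0.

Definition ils_objective (K : realType) (m n : nat) (J : 'M[K]_m)
    (A : 'M[K]_(m, n)) (b : 'cV[K]_m) (x : 'cV[K]_n) : K :=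
  ((b - A *m x)^T *m J *m (b - A *m x)) ord0 ord0.

Definition ils_solution (K : realType) (m n : nat) (J : 'M[K]_m)
    (A : 'M[K]_(m, n)) (b : 'cV[K]_m) (x : 'cV[K]_n) : Prop :=
  forall y : 'cV[K]_n, ils_objective J A b x <= ils_objective J A b y.

Definition normal_equation (K : realType) (m n : nat) (J : 'M[K]_m)
    (A : 'M[K]_(m, n)) (b : 'cV[K]_m) (x : 'cV[K]_n) : Prop :=
  A^T *m J *m A *m x = A^T *m J *m b.

(* [invmx P] is the inverse of [P] only when [P] is nonsingular, hence the
   first conjunct. *)
Definition double_splitting (K : realType) (n : nat)
    (M P R S : 'M[K]_n) : Prop :=
  P \in unitmx /\ M = P - R - S.

Fixpoint ds_iter (K : realType) (n : nat) (P R S : 'M[K]_n)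
    (c x0 x1 : 'cV[K]_n) (k : nat) : 'cV[K]_n :=
  match k with
  | 0%N => x0
  | k'.+1 =>
      match k' with
      | 0%N => x1
      | k''.+1 =>
          invmx P *m R *m ds_iter P R S c x0 x1 k'
          + invmx P *m S *m ds_iter P R S c x0 x1 k''
          + invmx P *m c
      end
  end.

Definition ds_convergent (K : realType) (n : nat) (P R S : 'M[K]_n)
    (c xstar : 'cV[K]_n) : Prop :=
  forall x0 x1 : 'cV[K]_n, ds_iter P R S c x0 x1 @ \oo --> xstar.

(* Main.v *)
(** The error [e_k = x_k - x*] satisfies [P e_(k+2) = R e_(k+1) + S e_k]. Since
    [R] and [S] are symmetric positive semidefinite, testing with [e_(k+2)],
    applying [2 u^T R v <= u^T R u + v^T R v] (and the same for [S]), and using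
    [P = M + R + S] with [M = A^T J A], one finds that the energy
    [V_k = (e_(k+1)^T (R + S) e_(k+1) + e_k^T S e_k) / 2] satisfies
    [V_(k+1) + e_(k+2)^T M e_(k+2) <= V_k]. Hence [V] converges,
    [e_k^T M e_k] tends to [0], and so does [e_k] as [M] is positive definite. *)

Require Import Defs.
From mathcomp Require Import all_boot all_order all_algebra.
From mathcomp Require Import all_classical all_reals all_analysis.
From mathcomp Require Import ring lra.
Import Order.TTheory GRing.Theory Num.Theory.
Import numFieldNormedType.Exports.
Set Implicit Arguments.
Unset Strict Implicit.

Local Open Scope classical_set_scope.
Local Open Scope ring_scope.

(** A neighbourhood of a matrix contains a box, given by one neighbourhood per entry, and a filter
    is closed under the finite intersection over the entries. *)
Lemma cvg_mx_entrywise (T : Type) (F : set_system T) (FF : Filter F)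
    (U : topologicalType) (m n : nat) (f : T -> 'M[U]_(m, n)) (l : 'M[U]_(m, n)) :
  (forall i j, f t i j @[t --> F] --> l i j) -> f @ F --> l.
Proof.
move=> fl A [B lB BA].
have nearB : \forall t \near F, forall ij : 'I_m * 'I_n, B ij.1 ij.2 (f t ij.1 ij.2).
  by apply: filter_forall => -[i j]; exact: (fl i j _ (lB i j)).
by apply: filterS nearB => t Bt; apply: BA => i j; exact: (Bt (i, j)).
Qed.

(** * Bilinear forms of matrices and definiteness *)

Section BilinearForm.
Variables (K : realType) (n : nat).
Implicit Types (M N : 'M[K]_n) (u v w : 'cV[K]_n).

Definition bform M u v : K := (u^T *m M *m v) ord0 ord0.

Lemma bformDm M N u v : bform (M + N) u v = bform M u v + bform N u v.
Proof. by rewrite /bform mulmxDr mulmxDl mxE. Qed.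

Lemma bformBl M u v w : bform M (u - v) w = bform M u w - bform M v w.
Proof. by rewrite /bform linearB /= !mulmxBl !mxE. Qed.

Lemma bformBr M u v w : bform M u (v - w) = bform M u v - bform M u w.
Proof. by rewrite /bform mulmxBr !mxE. Qed.

Lemma bformZl M a u v : bform M (a *: u) v = a * bform M u v.
Proof. by rewrite /bform linearZ /= -!scalemxAl mxE. Qed.

Lemma bformZr M a u v : bform M u (a *: v) = a * bform M u v.
Proof. by rewrite /bform -!scalemxAr mxE. Qed.

Lemma bform_sym M u v : M^T = M -> bform M u v = bform M v u.
Proof.
move=> symM; rewrite /bform.
have -> : u^T *m M *m v = (v^T *m M *m u)^T.
  by rewrite !trmx_mul trmxK symM mulmxA.
by rewrite mxE.
Qed.

Lemma bform_sqrB M u v : M^T = M ->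
  bform M (u - v) (u - v) = bform M u u - 2 * bform M u v + bform M v v.
Proof. by move=> symM; rewrite !bformBl !bformBr (bform_sym v u symM); ring. Qed.

Definition sym_possemidef M : Prop :=
  M^T = M /\ forall x, 0 <= bform M x x.

Lemma sym_posdef_bform_ge0 M x : sym_posdef M -> 0 <= bform M x x.
Proof.
move=> [_ posM]; have [->|/posM/ltW//] := eqVneq x 0.
by rewrite /bform mulmx0 mxE.
Qed.

Lemma sym_posdef_bform_le0 M x : sym_posdef M -> bform M x x <= 0 -> x = 0.
Proof.
by move=> [_ posM]; case: (eqVneq x 0) => // /posM xM /(lt_le_trans xM); rewrite ltxx.
Qed.

Lemma sym_posdefD M N :
  sym_posdef M -> sym_possemidef N -> sym_posdef (M + N).
Proof.
move=> [symM posM] [symN posN]; split; first by rewrite linearD /= symM symN.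
move=> x x0; rewrite -/(bform _ _ _) bformDm ltr_pwDl//; exact: posM.
Qed.

Lemma sym_posdef_unitmx M : sym_posdef M -> M \in unitmx.
Proof.
move=> pdM; rewrite -row_free_unit; apply: inj_row_free => v vM0.
suff : v^T = 0 by move/(congr1 trmx); rewrite trmxK trmx0.
by apply: (sym_posdef_bform_le0 pdM); rewrite /bform trmxK vM0 mul0mx mxE.
Qed.

Lemma bform_young M u v : sym_possemidef M ->
  2 * bform M u v <= bform M u u + bform M v v.
Proof.
move=> [symM posM]; have := posM (u - v).
by rewrite bform_sqrB//; lra.
Qed.

Lemma bform_cauchy_schwarz M u v : sym_posdef M ->
  bform M u v ^+ 2 <= bform M u u * bform M v v.
Proof.
move=> pdM; have [->|v0] := eqVneq v 0.
  by rewrite /bform !mulmx0 mxE expr0n mulr0.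
have symM := pdM.1; have qv_gt0 : 0 < bform M v v by exact: pdM.2.
(* The tested vector is the residual of projecting [u] onto [v], scaled by [bform M v v] to avoid a
   division. *)
have := sym_posdef_bform_ge0 (bform M v v *: u - bform M u v *: v) pdM.
rewrite !(bformBl, bformBr, bformZl, bformZr) (bform_sym v u symM).
set a := bform M u u; set c := bform M v v in qv_gt0 *; set h := bform M u v.
rewrite [X in 0 <= X](_ : _ = c * (a * c - h ^+ 2)); last by ring.
by rewrite pmulr_rge0// subr_ge0.
Qed.

End BilinearForm.

Lemma gram_sym_possemidef (K : realType) (m n : nat) (A : 'M[K]_(m, n)) :
  sym_possemidef (A^T *m A).
Proof.
split=> [|x]; first by rewrite trmx_mul trmxK.
rewrite /bform mulmxA -trmx_mul -mulmxA mxE sumr_ge0// => i _.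
by rewrite mxE -expr2 sqr_ge0.
Qed.

Lemma scalar_sym_possemidef (K : realType) (n : nat) (a : K) :
  0 <= a -> sym_possemidef (a%:M : 'M[K]_n).
Proof.
move=> a0; split=> [|x]; first by rewrite tr_scalar_mx.
rewrite /bform mul_mx_scalar -scalemxAl mxE mulr_ge0// mxE sumr_ge0// => i _.
by rewrite mxE -expr2 sqr_ge0.
Qed.

(* The form [M] controls each coordinate of [u]: [u_i = u^T M w] for the
   solution [w] of [M w = delta_i]. *)
Lemma sym_posdef_cvg (K : realType) (n : nat) (M : 'M[K]_n)
    (x : nat -> 'cV[K]_n) (l : 'cV[K]_n) : sym_posdef M ->
  bform M (x k - l) (x k - l) @[k --> \oo] --> 0 -> x @ \oo --> l.
Proof.
move=> pdM Mx0; apply: cvg_mx_entrywise => i j.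
rewrite (ord1 j) {j}; apply/subr_cvg0.
pose w : 'cV[K]_n := invmx M *m delta_mx i ord0.
have coordE (u : 'cV[K]_n) : u i ord0 = bform M u w.
  rewrite /bform /w -mulmxA mulKVmx; last exact: sym_posdef_unitmx.
  rewrite mxE (bigD1 i)//= big1 => [|k /negPf ki].
    by rewrite !mxE !eqxx mulr1 addr0.
  by rewrite !mxE ki mulr0.
(* By Cauchy-Schwarz this product bounds the square of the coordinate, and its second factor does
   not depend on [k]; hence the threshold [eps ^+ 2] below. *)
have Cm0 : bform M (x k - l) (x k - l) * bform M w w @[k --> \oo] --> 0.
  by rewrite -(mul0r (bform M w w)); apply: cvgMr_tmp.
apply/cvgr0Pnorm_lt => eps eps0.
have /cvgr0Pnorm_lt /(_ (eps ^+ 2)) := Cm0.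
rewrite exprn_gt0// => /(_ isT); apply: filterS => k /(le_lt_trans (ler_norm _)) lt_eps.
rewrite -(ltr_pXn2r (n := 2))// ?nnegrE ?normr_ge0 ?(ltW eps0)//.
rewrite real_normK ?num_real//; apply: le_lt_trans lt_eps.
have -> : x k i ord0 - l i ord0 = (x k - l) i ord0 by rewrite !mxE.
by rewrite coordE; exact: bform_cauchy_schwarz.
Qed.

(** * Energy decay and convergence of the iteration *)

(** Being nonincreasing and bounded below, [V] converges, so its successive drops tend to [0]; they
    dominate [m]. *)
Lemma cvg0_of_decrease (K : realType) (V m : nat -> K) :
  (forall k, 0 <= V k) -> (forall k, 0 <= m k) ->
  (forall k, V k.+1 + m k <= V k) -> m @ \oo --> 0.
Proof.
move=> V0 m0 Vm.
have cvgV : cvgn V.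
  apply: nonincreasing_is_cvgn.
    by apply/nonincreasing_seqP => k; have := m0 k; have := Vm k; lra.
  by exists 0 => _ [k _ <-].
have VV0 : V k - V k.+1 @[k --> \oo] --> 0.
  rewrite -(subrr (limn V)); apply: cvgB => //.
  by have := cvgV; rewrite -cvg_shiftS.
apply: (squeeze_cvgr _ (cvg_cst 0) VV0).
by near=> k; rewrite m0 /=; have := Vm k; lra.
Unshelve. all: by end_near.
Qed.

Lemma ds_convergent_posdef (K : realType) (n : nat) (M P R S : 'M[K]_n)
    (c xstar : 'cV[K]_n) :
  sym_posdef M -> sym_possemidef R -> sym_possemidef S ->
  double_splitting M P R S -> M *m xstar = c ->
  ds_convergent P R S c xstar.
Proof.
move=> pdM psdR psdS [unitP defM] Mxc x0 x1.
have defP : P = M + (R + S) by rewrite defM -(addrA P) -opprD subrK.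
set x := ds_iter P R S c x0 x1.
pose e k := x k - xstar; pose q (N : 'M[K]_n) k := bform N (e k) (e k).
(* Multiplying by [P] removes the inverse, and [c] cancels because [xstar] is a fixed point of the
   iteration. *)
have errE k : P *m e k.+2 = R *m e k.+1 + S *m e k.
  have Px : P *m x k.+2 = R *m x k.+1 + S *m x k + c.
    by rewrite /x /= !mulmxDr -!mulmxA !mulKVmx.
  have Pxstar : P *m xstar = c + (R *m xstar + S *m xstar).
    by rewrite defP !mulmxDl Mxc.
  by rewrite /e !mulmxBr Px Pxstar (opprD c) addrA addrK opprD addrACA.
have qE k : q P k.+2 = bform R (e k.+2) (e k.+1) + bform S (e k.+2) (e k).
  by rewrite /q /bform -!mulmxA errE mulmxDr !mxE.
(* The halves come from the two Young inequalities. As [S] acts two steps back, [V] carries its form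
   at two consecutive indices, so that [q S k.+1] cancels between [V k] and [V k.+1]. *)
pose V k := (q R k.+1 + q S k.+1 + q S k) / 2.
have V_decr k : V k.+1 + q M k.+2 <= V k.
  have := qE k; rewrite {1}/q defP !bformDm -!/(q _ _).
  have := bform_young (e k.+2) (e k.+1) psdR.
  have := bform_young (e k.+2) (e k) psdS.
  rewrite -!/(q _ _) /V; lra.
have q_ge0 N k : sym_possemidef N -> 0 <= q N k by case=> _; exact.
have qM_cvg : (fun k => q M k.+2) @ \oo --> 0.
  apply: cvg0_of_decrease V_decr => k.
    by rewrite /V divr_ge0// !addr_ge0// q_ge0.
  exact: sym_posdef_bform_ge0.
(* The decay estimate starts at index 2, since [x0] and [x1] are arbitrary. *)
apply: (sym_posdef_cvg pdM); rewrite -(cvg_shiftn 2) [X in X @ _ --> _](_ : _ = fun k => q M k.+2)//.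
by apply/funext => k; rewrite /= addn2.
Qed.

(** * The least squares problem and its normal equation *)

Lemma ils_objective_normal (K : realType) (m n : nat) (J : 'M[K]_m)
    (A : 'M[K]_(m, n)) (b : 'cV[K]_m) (x y : 'cV[K]_n) :
  J^T = J -> normal_equation J A b x ->
  ils_objective J A b y =
    ils_objective J A b x + bform (A^T *m J *m A) (y - x) (y - x).
Proof.
move=> symJ nex; pose d := y - x; pose r := b - A *m x.
have resE : b - A *m y = r - A *m d by rewrite mulmxBr /r opprB addrA subrK.
rewrite /ils_objective resE -[LHS]/(bform J _ _).
(* The normal equation says that the residual is [J]-orthogonal to the range of [A], which kills the
   cross term. *)
have orth : bform J (A *m d) r = 0.
  have Ar : A^T *m (J *m r) = 0.
    by rewrite /r !mulmxBr !mulmxA nex subrr.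
  by rewrite /bform trmx_mul -!mulmxA Ar mulmx0 mxE.
rewrite (bform_sqrB r (A *m d) symJ) (bform_sym r _ symJ) orth mulr0 subr0.
by congr (_ + _); rewrite /bform trmx_mul !mulmxA.
Qed.

Lemma unique_normal_equation (K : realType) (m n : nat) (J : 'M[K]_m)
    (A : 'M[K]_(m, n)) (b : 'cV[K]_m) (x : 'cV[K]_n) :
  A^T *m J *m A \in unitmx -> normal_equation J A b x ->
  unique (normal_equation J A b) x.
Proof.
move=> unitM nex; split=> // y ney.
by rewrite -(mulKmx unitM x) nex -ney mulKmx.
Qed.

(** The objective at [y] exceeds that at [x] by the form of [A^T *m J *m A] at [y - x], which is
    nonnegative and vanishes only for [y = x]. *)
Lemma unique_ils_solution (K : realType) (m n : nat) (J : 'M[K]_m)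
    (A : 'M[K]_(m, n)) (b : 'cV[K]_m) (x : 'cV[K]_n) :
  J^T = J -> sym_posdef (A^T *m J *m A) -> normal_equation J A b x ->
  unique (ils_solution J A b) x.
Proof.
move=> symJ pdM nex; split=> [y|y ysol].
  by rewrite (ils_objective_normal y symJ nex) lerDl; exact: sym_posdef_bform_ge0.
have := ysol x; rewrite (ils_objective_normal y symJ nex) gerDl.
by move/(sym_posdef_bform_le0 pdM)/eqP; rewrite subr_eq0 => /eqP.
Qed.

Lemma signature_mx_sym (K : realType) (p q : nat) :
  (signature_mx K p q)^T = signature_mx K p q.
Proof. by rewrite /signature_mx tr_block_mx !trmx0 linearN /= !trmx1. Qed.

Lemma col_mx_signature (K : realType) (n p q : nat)
    (A1 : 'M[K]_(p, n)) (A2 : 'M[K]_(q, n)) :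
  (col_mx A1 A2)^T *m signature_mx K p q *m col_mx A1 A2
  = A1^T *m A1 - A2^T *m A2.
Proof.
rewrite tr_col_mx mul_row_block mul_row_col !mulmx0 !mulmx1 addr0 add0r.
by rewrite mulmxN mulmx1 mulNmx.
Qed.

Theorem theorem2p1 (K : realType) (n p q : nat)
    (hn : (0 < n)%N) (hp : (0 < p)%N) (hq : (0 < q)%N) (hm : (n <= p + q)%N)
    (A1 : 'M[K]_(p, n)) (A2 : 'M[K]_(q, n)) (b : 'cV[K]_(p + q))
    (hA1 : \rank A1 = n) :
  let A : 'M[K]_(p + q, n) := col_mx A1 A2 in
  let J : 'M[K]_(p + q) := signature_mx K p q in
  sym_posdef (A^T *m J *m A) ->
  forall alpha : K, 0 < alpha ->
  let P : 'M[K]_n := alpha%:M + A1^T *m A1 in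
  let R : 'M[K]_n := A2^T *m A2 in
  let S : 'M[K]_n := alpha%:M in
  double_splitting (A^T *m J *m A) P R S /\
  exists xstar : 'cV[K]_n,
    [/\ unique (ils_solution J A b) xstar,
        unique (normal_equation J A b) xstar &
        ds_convergent P R S (A^T *m J *m b) xstar].
Proof.
move=> A J pdM alpha alpha0 P R S.
have psdR : sym_possemidef R by exact: gram_sym_possemidef.
have psdS : sym_possemidef S by apply: scalar_sym_possemidef; exact: ltW.
have defM : A^T *m J *m A = P - R - S.
  by rewrite col_mx_signature /P /R /S (addrC alpha%:M) addrAC addrK.
have splitM : double_splitting (A^T *m J *m A) P R S.
  (* In this form [P] is positive definite plus two semidefinite terms, hence nonsingular. *)
  split=> //; have -> : P = A^T *m J *m A + S + R by rewrite defM !subrK.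
  by apply: sym_posdef_unitmx; do 2?apply: sym_posdefD.
have unitM := sym_posdef_unitmx pdM.
split=> //; exists (invmx (A^T *m J *m A) *m (A^T *m J *m b)).
have nex : normal_equation J A b (invmx (A^T *m J *m A) *m (A^T *m J *m b)).
  exact: mulKVmx.
split; last exact: ds_convergent_posdef pdM psdR psdS splitM nex.
- exact: unique_ils_solution (signature_mx_sym K p q) pdM nex.
- exact: unique_normal_equation unitM nex.
Qed.
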